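(* Let $D>1$ be real and let $(V,\omega,\mu)$ be the radial path graph with parameter $D$ (defined in the context). For $1<p<\infty$, a nonempty finite subset $\Omega\subset V$ and $w:\Omega\to\mathbb{R}$, consider the Dirichlet problem $$-\Delta_p^\omega u(x)=w(x)|u(x)|^{p-2}u(x)\quad (x\in\Omega),\qquad u(x)=0\quad (x\in V\setminus\Omega).\qquad ( * )$$ Then the following estimates hold. (i) If $p>D$, there exists a constant $c>0$, depending only on $p,D$, such that, whenever $\tau_\Omega\ge2$ and $( * )$ admits a nontrivial solution $u\in X_V(\Omega)$, $$\|w_+\|_{\ell^1(\Omega,\mu)}\ge c\,\tau_\Omega^{-(p-D)}.$$ (ii) If $p=D$, there exists a constant $c>0$, depending only on $D$, such that, whenever $\tau_\Omega\ge2$ and $( * )$ admits a nontrivial solution $u\in X_V(\Omega)$, $$\|w_+\|_{\ell^1(\Omega,\mu)}\ge c(\log\tau_\Omega)^{1-p}.$$ (iii) If $1<p<D$ and $s>D/p$, there exists a constant $c>0$, depending only on $p,D,s$, such that, whenever $\tau_\Omega\ge2$ and $( * )$ admits a nontrivial solution $u\in X_V(\Omega)$, $$\|w_+\|_{\ell^s(\Omega,\mu)}\ge c\,\tau_\Omega^{-\left(p-\frac{D}{s}\right)}.$$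
   Context: The radial path graph with parameter $D>1$ has vertex set $V=\mathbb{N}_0=\{0,1,2,\dots\}$, adjacency $m\sim n$ iff $|m-n|=1$, vertex measure $\mu(n)=(n+1)^{D-1}$, and edge weights $\omega_{n,n+1}=\omega_{n+1,n}=(n+1)^{D-1}$ for $n\in\mathbb{N}_0$, all other weights being zero. For a nonempty finite $\Omega\subset V$, the radial outer radius is $\tau_\Omega=\max\{n:n\in\Omega\}$. $X_V(\Omega)=\{u:V\to\mathbb{R}:u=0\text{ in }V\setminus\Omega\}$; a solution is nontrivial if it is not identically zero. The discrete $p$-Laplacian is $\Delta_p^\omega u(x)=\frac{1}{\mu(x)}\sum_{y\sim x}\omega_{xy}|u(y)-u(x)|^{p-2}(u(y)-u(x))$, with the convention $|t|^{p-2}t=0$ at $t=0$. $w_+(x)=\max\{w(x),0\}$ and, for $1\le r<\infty$, $\|f\|_{\ell^r(\Omega,\mu)}=(\sum_{x\in\Omega}\mu(x)|f(x)|^r)^{1/r}$. *)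

(* Defs.v *)
From HB Require Import structures.
From mathcomp Require Import all_boot all_order all_algebra finmap.
From mathcomp Require Import all_classical all_reals all_analysis.

Set Implicit Arguments.
Unset Strict Implicit.
Unset Printing Implicit Defensive.

Import Order.TTheory GRing.Theory Num.Theory.
Local Open Scope fset_scope.
Local Open Scope classical_set_scope.
Local Open Scope ring_scope.

(* |t|^(p-2) t.  At t = 0 the factor t makes this 0 whatever the value
   of powR at 0. *)
Definition phi (R : realType) (p t : R) : R := `|t| `^ (p - 2) * t.

Section WeightedGraph.
Context {R : realType} {V : choiceType}.
Variables (adj : rel V) (omega : V -> V -> R) (mu : V -> R).

(* The sum over the neighbours of x is a finitely supported sum, hence the
   usual one for locally finite graphs. *)
Definition pLaplacian (p : R) (u : V -> R) (x : V) : R :=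
  (mu x)^-1 * \sum_(y \in [set y | adj x y]) (omega x y * phi p (u y - u x)).

Definition XV (Omega : {fset V}) : set (V -> R) :=
  [set u | forall x, x \notin Omega -> u x = 0].

Definition dirichlet_solution (p : R) (Omega : {fset V}) (w : Omega -> R)
    (u : V -> R) : Prop :=
  (forall x : Omega, - pLaplacian p u (val x) = w x * phi p (u (val x))) /\
  (forall x : V, x \notin Omega -> u x = 0).

Definition has_nontrivial_solution (p : R) (Omega : {fset V})
    (w : Omega -> R) : Prop :=
  exists u : V -> R,
    [/\ XV Omega u, dirichlet_solution p w u & exists x, u x != 0].

Definition lnorm (r : R) (Omega : {fset V}) (f : Omega -> R) : R :=
  (\sum_(x : Omega) mu (val x) * `|f x| `^ r) `^ r^-1.

End WeightedGraph.

Definition radial_adj : rel nat := fun m n => `|m%:Z - n%:Z| == 1.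

Definition radial_mu (R : realType) (D : R) (n : nat) : R :=
  n.+1%:R `^ (D - 1).

(* An edge is {k, k+1} with k the smaller endpoint. *)
Definition radial_omega (R : realType) (D : R) (m n : nat) : R :=
  if radial_adj m n then (minn m n).+1%:R `^ (D - 1) else 0.

Definition outer_radius (Omega : {fset nat}) : nat := (\max_(n <- Omega) n)%N.

(* Main.v *)
Require Import Defs.
From HB Require Import structures.
From mathcomp Require Import all_boot all_order all_algebra finmap.
From mathcomp Require Import all_classical all_reals all_analysis.
From mathcomp Require Import ring lra zify.
Import Order.TTheory GRing.Theory Num.Theory.
Local Open Scope fset_scope.
Local Open Scope classical_set_scope.
Local Open Scope ring_scope.

(** The three estimates are Lyapunov inequalities, and all of them come from one
inequality on the path.

Let N be the outer radius of Omega, a_k the weight of the edge {k, k+1} and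
m_n the vertex measure. Multiplying the equation by m u and summing by parts
bounds the energy E = sum a_k |u(k+1) - u(k)|^p by sum m_n w_+(n) |u(n)|^p
(solution_lyapunov, sum_by_parts). Conversely, u vanishes at N+1, so u(n) is a
telescoping sum of the increments over the edges n, ..., N; Hoelder's inequality
gives |u(n)|^p <= S_n^(p-1) E, where S_n = sum_(n <= k <= N) a_k^(-1/(p-1)) is
the resistance of the path from n to the boundary (pointwise_le_energy).
Substituting and dividing by E > 0 eliminates the solution (path_lyapunov):

  1 <= sum_(n <= N) m_n w_+(n) S_n^(p-1).

What remains is the size of S_n on the radial graph, where S_n is the sum of
(k+1)^(-alpha), n <= k <= N, with alpha = (D-1)/(p-1).

- If p >= D, then alpha <= 1 and S_n <= S_0, which leaves the l^1 norm of w_+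
  times S_0^(p-1). Here S_0 is of order N^(1-alpha) if p > D, and
  (1-alpha)(p-1) = p - D; it is of order log N if p = D.
- If p < D, then alpha > 1 and S_n^(p-1) is at most a constant times
  (n+1)^(-(D-p)), whatever N is. Hoelder's inequality with exponents s and
  s' = s/(s-1) leaves the l^s norm of w_+ times the l^s' norm of
  (n+1)^(-(D-p)). The condition s > D/p says exactly that the exponent
  D - 1 - (D-p)s' exceeds -1, so that this last norm grows like the power
  p - D/s of N. Since s is strictly above the critical exponent, the pointwise
  bound on u already gives the sharp power of N.

The power sums are compared with telescoping sums, the comparison of one term
being the Bernoulli-type bound (1 - t)^g <= 1 - min(g,1) t (onem_powR_le). *)

(** * Hoelder's inequality for weighted finite sums *)

(** Induction on the index sequence: with A and B the two norms over the tail,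
the step is the two-term inequality for (f i, A) and (g i, B), so that
vanishing norms need no separate treatment. *)
Lemma hoelder_sum (R : realType) (I : Type) (r : seq I) (m f g : I -> R)
    (p q : R) : 0 < p -> 0 < q -> p^-1 + q^-1 = 1 ->
  (forall i, 0 <= m i) -> (forall i, 0 <= f i) -> (forall i, 0 <= g i) ->
  \sum_(i <- r) m i * (f i * g i) <=
  (\sum_(i <- r) m i * f i `^ p) `^ p^-1 *
  (\sum_(i <- r) m i * g i `^ q) `^ q^-1.
Proof.
move=> p0 q0 pq m0 f0 g0.
have root (h : I -> R) (e : R) : 0 < e -> (forall i, 0 <= h i) ->
    forall s : seq I, exists A, [/\ 0 <= A,
      A `^ e = \sum_(i <- s) m i * h i `^ e &
      A = (\sum_(i <- s) m i * h i `^ e) `^ e^-1].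
  move=> e0 h0 s; exists ((\sum_(i <- s) m i * h i `^ e) `^ e^-1).
  rewrite powR_ge0 -powRrM mulVf ?gt_eqF// powRr1//.
  by apply: sumr_ge0 => i _; rewrite mulr_ge0 ?powR_ge0.
elim: r => [|i r IH]; first by rewrite big_nil mulr_ge0 ?powR_ge0.
have [A [A0 Ap AE]] := root f p p0 f0 r.
have [B [B0 Bq BE]] := root g q q0 g0 r.
rewrite -AE -BE in IH; rewrite !big_cons -Ap -Bq.
have scale (h e : R) : 0 <= h -> 0 < e ->
    (m i `^ e^-1 * h) `^ e = m i * h `^ e.
  by move=> h0 e0; rewrite powRM ?powR_ge0// -powRrM mulVf ?gt_eqF// powRr1.
have mE : m i * (f i * g i) = (m i `^ p^-1 * f i) * (m i `^ q^-1 * g i).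
  by rewrite mulrACA -powRD ?pq ?powRr1// oner_eq0.
rewrite -(scale (f i) p)// -(scale (g i) q)// mE.
apply: le_trans (hoelder2 _ _ _ _ p0 q0 pq); rewrite ?mulr_ge0 ?powR_ge0//.
by rewrite lerD2l.
Qed.

(** * Power sums by telescoping *)

(** For g >= 1 the left side is at most 1 - t; for g < 1 this is Young's
inequality for (1 - t)^g * 1 with exponents 1/g and 1/(1-g). *)
Lemma onem_powR_le (R : realType) (g t : R) : 0 < g -> 0 <= t <= 1 ->
  (1 - t) `^ g <= 1 - Num.min g 1 * t.
Proof.
move=> g0 /andP[t0 t1].
have t1' : 0 <= 1 - t by rewrite subr_ge0.
have [g1|g1] := leP 1 g.
  rewrite mul1r; move: t1'; rewrite le_eqVlt => /predU1P[<-|t1'].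
    by rewrite powR0 ?gt_eqF.
  by apply: ge1r_powR => //; rewrite t1' gerBl.
have := @conjugate_powR _ ((1 - t) `^ g) 1 g^-1 (1 - g)^-1 (powR_ge0 _ _) ler01.
rewrite !invr_gt0 subr_gt0 g0 g1 !invrK subrKC => /(_ isT isT erefl).
rewrite mulr1 -powRrM mulfV ?gt_eqF// powRr1// powR1 mul1r => /le_trans; apply.
by rewrite le_eqVlt; apply/orP; left; apply/eqP; ring.
Qed.

(** A substitute for the mean value theorem with an explicit constant: factor
out y^g and apply the previous bound at t = 1/y. *)
Lemma powR_step (R : realType) (g y : R) : 0 < g -> 1 <= y ->
  Num.min g 1 * y `^ (g - 1) <= y `^ g - (y - 1) `^ g.
Proof.
move=> g0 y1; have y0 : 0 < y by exact: lt_le_trans y1.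
have yn0 : y != 0 by rewrite gt_eqF.
have ty : 0 <= y^-1 <= 1 by rewrite invr_ge0 (ltW y0) invf_le1.
have /andP[_ t1] := ty.
have -> : y - 1 = y * (1 - y^-1) by rewrite mulrBr mulr1 mulfV.
rewrite powRM ?subr_ge0 ?(ltW y0)//.
rewrite (@powRB _ y g 1) ?yn0 ?implybT// powRr1 ?(ltW y0)//.
rewrite mulrCA -[X in _ <= X - _]mulr1 -mulrBr ler_wpM2l ?powR_ge0//.
by rewrite lerBrDr addrC -lerBrDr onem_powR_le.
Qed.

Lemma sum_powR_le (R : realType) (b : R) (n : nat) : -1 < b ->
  \sum_(0 <= k < n) k.+1%:R `^ b <= (Num.min (b + 1) 1)^-1 * n%:R `^ (b + 1).
Proof.
move=> b1; have g0 : 0 < b + 1 by lra.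
have c0 : 0 < Num.min (b + 1) 1 by rewrite lt_min g0 ltr01.
rewrite ler_pdivlMl// mulr_sumr.
apply: (@le_trans _ _ (\sum_(0 <= k < n)
    ((k.+1%:R : R) `^ (b + 1) - k%:R `^ (b + 1)))).
  apply: ler_sum_nat => k _.
  have := powR_step _ _ (k.+1%:R) g0; rewrite ler1n => /(_ isT).
  by rewrite addrK -[in X in _ - X `^ _]natr1 addrK.
rewrite (telescope_sumr (fun k : nat => (k%:R : R) `^ (b + 1)))//.
by rewrite powR0 ?gt_eqF// subr0.
Qed.

(** The increments of x^(-g) are obtained from those of x^g upon division by
x^g (x+1)^g; the factor 2 absorbs x + 1 <= 2 x. The bound is uniform in N. *)
Lemma sum_powR_tail_le (R : realType) (g : R) (n N : nat) : 0 < g ->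
  (n <= N)%N ->
  \sum_(n <= k < N) k.+1%:R `^ (- (g + 1)) <=
    2 * (Num.min g 1)^-1 * n.+1%:R `^ (- g).
Proof.
move=> g0 nN; have c0 : 0 < Num.min g 1 by rewrite lt_min g0 ltr01.
rewrite -mulrA (mulrCA 2) ler_pdivlMl// mulr_sumr.
apply: (@le_trans _ _ (\sum_(n <= k < N)
    (- 2 * (k.+2%:R : R) `^ (- g) - - 2 * k.+1%:R `^ (- g)))); last first.
  rewrite (telescope_sumr (fun k : nat => - 2 * (k.+1%:R : R) `^ (- g)))//.
  by rewrite mulNr mulNr opprK gerDr oppr_le0 mulr_ge0 ?powR_ge0.
apply: ler_sum_nat => k _.
set x : R := k.+1%:R; set c := Num.min g 1 in c0 *.
have x1 : 1 <= x by rewrite /x ler1n.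
have x0 : 0 < x by exact: lt_le_trans x1.
have -> : k.+2%:R = x + 1 :> R by rewrite natr1.
have y0 : 0 < x + 1 by lra.
have := powR_step R g (x + 1) g0 ltac:(lra); rewrite addrK -/c => step.
have xg : 0 < x `^ g by exact: powR_gt0.
have yg : 0 < (x + 1) `^ g by exact: powR_gt0.
rewrite opprD !powRD ?(gt_eqF x0) ?implybT// !powRN powRr1 ?(ltW x0)//.
move: step; rewrite powRD ?(gt_eqF y0) ?implybT// powRN powRr1 ?(ltW y0)//.
move: xg yg; move: (x `^ g) ((x + 1) `^ g) => X Y X0 Y0 step.
have h : c <= (Y - X) / Y * (x + 1).
  by rewrite -ler_pdivrMr// ler_pdivlMr// mulrAC -mulrA.
have -> : - 2 * Y^-1 - - 2 * X^-1 = (2 * ((Y - X) / Y)) / X.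
  by field; rewrite !gt_eqF.
have A0 : 0 <= (Y - X) / Y.
  rewrite -(pmulr_lge0 _ y0); exact: le_trans (ltW c0) h.
have -> : c * (X^-1 * x^-1) = c / x / X by ring.
rewrite ler_wpM2r ?invr_ge0 ?(ltW X0)// ler_pdivrMr//.
by apply: le_trans h _; nra.
Qed.

Lemma sum_inv_le_ln (R : realType) (n : nat) : (0 < n)%N ->
  \sum_(0 <= k < n) (k.+1%:R : R)^-1 <= 1 + ln n%:R.
Proof.
elim: n => // -[|n] IH _; first by rewrite big_nat1 invr1 ln1 addr0.
rewrite big_nat_recr//=; have {}IH := IH isT.
have n0 : 0 < n.+1%:R :> R by rewrite ltr0n.
have n1 : 0 < n.+2%:R :> R by rewrite ltr0n.
have v1 : -1 < - (n.+2%:R : R)^-1 by rewrite ltrN2 invf_lt1// ltr1n.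
have := le_ln1Dx v1.
have -> : 1 + - (n.+2%:R : R)^-1 = n.+1%:R / n.+2%:R.
  by rewrite -[n.+1%:R](addrK 1) natr1 mulrBl mulfV ?mul1r ?gt_eqF.
rewrite lnM ?posrE ?invr_gt0// lnV ?posrE// => step.
apply: le_trans (lerD IH (lexx _)) _; rewrite -addrA lerD2l.
by move: step; rewrite lerBlDr [leRHS]addrC lerBrDr.
Qed.

(** * A Lyapunov inequality on weighted paths *)

Definition path_energy {R : realType} (a : nat -> R) (p : R) (u : nat -> R)
    (N : nat) : R :=
  \sum_(0 <= k < N.+1) a k * `|u k.+1 - u k| `^ p.

(** Resistances in series add up in the p-Laplacian setting once they are raised
to the power 1/(p-1): the effective p-resistance between n and N+1 is the power
p - 1 of this sum. *)
Definition path_resistance {R : realType} (a : nat -> R) (p : R)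
    (n N : nat) : R :=
  \sum_(n <= k < N.+1) a k `^ (- (p - 1)^-1).

Lemma phiM_self (R : realType) (p t : R) : 1 < p -> phi p t * t = `|t| `^ p.
Proof.
move=> p1; rewrite /phi -mulrA -expr2 -real_normK ?num_real//.
have [->|t0] := eqVneq t 0.
  by rewrite normr0 expr0n mulr0 powR0// gt_eqF// (lt_trans ltr01).
have t0' : `|t| != 0 by rewrite normr_eq0.
rewrite -powR_mulrn ?normr_ge0// -powRD ?t0' ?implybT//.
by congr (_ `^ _); lra.
Qed.

(** The left side is minus the divergence of the flow F, tested against u.
There is no edge below 0, hence no boundary term there, and u N.+1 = 0 removes
the other. *)
Lemma sum_by_parts (R : realType) (u F : nat -> R) (N : nat) :
  u N.+1 = 0 ->
  \sum_(0 <= x < N.+1) ((if x is y.+1 then F y else 0) - F x) * u x =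
  \sum_(0 <= k < N.+1) F k * (u k.+1 - u k).
Proof.
move=> uN.
have gen n : \sum_(0 <= x < n) ((if x is y.+1 then F y else 0) - F x) * u x =
    \sum_(0 <= k < n) F k * (u k.+1 - u k) -
    (if n is y.+1 then F y * u n else 0).
  elim: n => [|n IH]; first by rewrite !big_nil subr0.
  by rewrite !big_nat_recr//= IH; case: n {IH} => [|n]; ring.
by rewrite gen uN mulr0 subr0.
Qed.

(** Write u(n) as the sum of its increments up to N+1 and apply Hoelder's
inequality with weights a_k to |u(k+1) - u(k)| and 1/a_k; the conjugate exponent
q = p/(p-1) turns a_k * a_k^(-q) into the summand of the resistance. *)
Lemma pointwise_le_energy (R : realType) (a : nat -> R) (p : R)
    (u : nat -> R) (n N : nat) : 1 < p -> (forall k, 0 < a k) ->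
  u N.+1 = 0 -> (n <= N)%N ->
  `|u n| `^ p <= path_resistance a p n N `^ (p - 1) * path_energy a p u N.
Proof.
move=> p1 a0 uN nN; have p0 : 0 < p by lra.
have q0 : 0 < p / (p - 1) by rewrite divr_gt0//; lra.
have pq : p^-1 + (p / (p - 1))^-1 = 1 by field; rewrite !gt_eqF//; lra.
have eS : 1 + -1 * (p / (p - 1)) = - (p - 1)^-1.
  by field; rewrite gt_eqF//; lra.
have le_sum : `|u n| <= \sum_(n <= k < N.+1)
    a k * (`|u k.+1 - u k| * (a k)^-1).
  have -> : `|u n| = `|u N.+1 - u n| by rewrite uN sub0r normrN.
  rewrite -(telescope_sumr u (leqW nN)).
  apply: le_trans (ler_norm_sum _ _ _) _; apply: ler_sum => k _.
  by rewrite mulrCA mulfV ?mulr1// gt_eqF.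
have := hoelder_sum R nat (index_iota n N.+1) a
  (fun k => `|u k.+1 - u k|) (fun k => (a k)^-1) p (p / (p - 1)) p0 q0 pq.
move=> /(_ (fun k => ltW (a0 k)) (fun k => normr_ge0 _)).
have ai0 k : 0 <= (a k)^-1 by rewrite invr_ge0 ltW.
move=> /(_ ai0) /(le_trans le_sum) {le_sum}.
set E1 := \sum_(_ <- _) _; set S1 := \sum_(_ <- _) _ => le.
have SE : S1 = path_resistance a p n N.
  apply: eq_bigr => k _; rewrite -powR_inv1 ?(ltW (a0 k))// -powRrM.
  rewrite -{1}(powRr1 (ltW (a0 k))) -powRD.
    by rewrite eS.
  by rewrite (gt_eqF (a0 k)) implybT.
have E10 : 0 <= E1.
  by apply: sumr_ge0 => k _; rewrite mulr_ge0 ?powR_ge0 ?ltW.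
have EE : E1 <= path_energy a p u N.
  rewrite /path_energy (big_cat_nat (n := n))//= ?leqW// lerDr.
  by apply: sumr_ge0 => k _; rewrite mulr_ge0 ?powR_ge0 ?ltW.
move: E1 S1 SE E10 EE le => E S -> E0 EE le.
have {}le : `|u n| `^ p <=
    (E `^ p^-1 * path_resistance a p n N `^ (p / (p - 1))^-1) `^ p.
  by apply: ge0_ler_powR => //; rewrite ?nnegrE ?mulr_ge0 ?powR_ge0 ?ltW.
apply: le_trans le _; rewrite powRM ?powR_ge0// -!powRrM mulVf ?gt_eqF//.
rewrite powRr1// invf_div divfK ?gt_eqF// mulrC.
by rewrite ler_wpM2l ?powR_ge0.
Qed.

(** Bounding |u(n)|^p by the energy on the right of the energy hypothesis
produces the factor E on both sides. It is positive because E = 0 would force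
u = 0. *)
Lemma path_lyapunov (R : realType) (a m V u : nat -> R) (p : R) (N : nat) :
  1 < p -> (forall k, 0 < a k) -> (forall n, 0 <= m n) ->
  (forall n, 0 <= V n) -> u N.+1 = 0 ->
  (exists2 n, (n <= N)%N & u n != 0) ->
  path_energy a p u N <= \sum_(0 <= n < N.+1) m n * (V n * `|u n| `^ p) ->
  1 <= \sum_(0 <= n < N.+1) m n * (V n * path_resistance a p n N `^ (p - 1)).
Proof.
move=> p1 a0 m0 V0 uN [n nN un0] le.
have E0 : 0 < path_energy a p u N.
  rewrite lt_neqAle; apply/andP; split; last first.
    by apply: sumr_ge0 => k _; rewrite mulr_ge0 ?powR_ge0 ?ltW.
  apply/eqP => E0; have := pointwise_le_energy R a p u n N p1 a0 uN nN.
  rewrite -E0 mulr0 leNgt => /negP; apply.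
  by rewrite powR_gt0// normr_gt0.
rewrite -(ler_pM2r E0) mul1r; apply: le_trans le _.
rewrite mulr_suml; apply: ler_sum_nat => k /andP[_ kN].
rewrite -!mulrA !ler_wpM2l//; exact: pointwise_le_energy.
Qed.

(** * The radial path graph *)

Lemma radial_mu_gt0 (R : realType) (D : R) (n : nat) : 0 < radial_mu D n.
Proof. by rewrite powR_gt0// ltr0n. Qed.

(** The vertex measure at k equals the weight of the edge {k, k+1}, so both
neighbours contribute values of the same flow F. *)
Lemma radial_pLaplacianE (R : realType) (D p : R) (u : nat -> R) (x : nat) :
  let F k := radial_mu D k * phi p (u k.+1 - u k) in
  radial_mu D x *
    (- pLaplacian radial_adj (radial_omega D) (radial_mu D) p u x) =
  (if x is y.+1 then F y else 0) - F x.
Proof.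
move=> F.
have mu0 : radial_mu D x != 0 by rewrite gt_eqF// radial_mu_gt0.
rewrite mulrN /pLaplacian mulrA mulfV// mul1r.
have up k : radial_omega D k k.+1 = radial_mu D k.
  rewrite /radial_omega /radial_adj; have -> : `|k%:Z - k.+1%:Z| == 1 by lia.
  by rewrite (minn_idPl _).
have down k : radial_omega D k.+1 k = radial_mu D k.
  rewrite /radial_omega /radial_adj; have -> : `|k.+1%:Z - k%:Z| == 1 by lia.
  by rewrite (minn_idPr _).
case: x {mu0} => [|x].
  have -> : [set y | radial_adj 0 y] = [set 1%N].
    by apply/seteqP; split => y /=; rewrite /radial_adj; [lia|move=> ->].
  by rewrite fsbig_set1 up sub0r.
have -> : [set y | radial_adj x.+1 y] = [set` [:: x; x.+2]].
  by apply/seteqP; split => y /=; rewrite /radial_adj !inE; lia.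
rewrite -fsbig_seq/=; last by rewrite !inE; lia.
rewrite !big_cons big_nil up down addr0 /F.
have -> : phi p (u x - u x.+1) = - phi p (u x.+1 - u x).
  by rewrite /phi -mulrN opprB distrC.
ring.
Qed.

(** V is the extension of w_+ by zero to all vertices. It makes sums over Omega
into sums over 0, ..., N: vertices outside Omega contribute nothing since both
V and u vanish there. *)
Lemma solution_lyapunov (R : realType) (D p : R) (Omega : {fset nat})
    (w : Omega -> R) : 1 < p ->
  has_nontrivial_solution radial_adj (radial_omega D) (radial_mu D) p w ->
  let N := outer_radius Omega in
  exists V : nat -> R,
  [/\ forall n, 0 <= V n,
      forall r, 0 < r -> lnorm (radial_mu D) r w^\+ =
        (\sum_(0 <= n < N.+1) radial_mu D n * V n `^ r) `^ r^-1
    & 1 <= \sum_(0 <= n < N.+1) radial_mu D n *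
             (V n * path_resistance (radial_mu D) p n N `^ (p - 1))].
Proof.
move=> p1 [u [_ [eqn u0] [z uz]]] N.
pose V n : R := if insub n is Some x then w^\+ x else 0.
have V0 n : 0 <= V n.
  by rewrite /V; case: insub => [x|//]; exact: funrpos_ge0.
have Vval (x : Omega) : V (val x) = w^\+ x by rewrite /V valK.
have Vout n : n \notin Omega -> V n = 0 by move=> nO; rewrite /V insubN.
have Omega_le n : n \in Omega -> (n <= N)%N.
  by move=> nO; rewrite /N /outer_radius leq_bigmax_seq.
have uN : u N.+1 = 0.
  by apply: u0; apply: contraTN isT => /Omega_le; rewrite ltnn.
exists V; split => //.
- move=> r r0; rewrite /lnorm; congr (_ `^ _).
  under eq_bigr do rewrite -Vval ger0_norm//.
  rewrite -(big_seq_fsetE _ _ xpredT (fun n => radial_mu D n * V n `^ r)).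
  rewrite [RHS](bigID (fun n => n \in Omega))/=.
  rewrite [X in _ = _ + X]big1 ?addr0; last first.
    by move=> n /Vout ->; rewrite powR0 ?mulr0 ?gt_eqF.
  rewrite -[RHS]big_filter; apply: perm_big; apply: uniq_perm.
  + exact: fset_uniq.
  + by rewrite filter_uniq ?iota_uniq.
  + move=> n; rewrite mem_filter mem_index_iota /= ltnS.
    by case: (boolP (n \in Omega)) => // /Omega_le ->.
- apply: (@path_lyapunov _ _ _ _ u) => //.
  + by move=> k; exact: radial_mu_gt0.
  + by move=> k; exact: ltW (radial_mu_gt0 _ _ _).
  + exists z => //; apply: Omega_le; apply: contraTT uz => /u0 ->.
    by rewrite eqxx.
  + pose F k := radial_mu D k * phi p (u k.+1 - u k).
    have -> : path_energy (radial_mu D) p u N =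
        \sum_(0 <= k < N.+1) F k * (u k.+1 - u k).
      by apply: eq_bigr => k _; rewrite -mulrA phiM_self.
    rewrite -sum_by_parts//; apply: ler_sum => n _.
    rewrite -radial_pLaplacianE.
    have [nO|nO] := boolP (n \in Omega); last first.
      by rewrite (u0 _ nO) mulr0 Vout// mul0r mulr0.
    have /= -> := eqn [` nO].
    have -> : V n = w^\+ [` nO] by rewrite -Vval.
    rewrite -mulrA -(mulrA (w _)) phiM_self//.
    rewrite ler_wpM2l ?(ltW (radial_mu_gt0 _ _ _))//.
    by rewrite ler_wpM2r ?powR_ge0// /funrpos le_max lexx.
Qed.

Lemma natS_powR_le (R : realType) (e : R) (N : nat) : (1 < N)%N -> 0 <= e ->
  (N.+1%:R : R) `^ e <= 2 `^ e * N%:R `^ e.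
Proof.
move=> N2 e0; rewrite -powRM//.
by apply: ge0_ler_powR; rewrite ?nnegrE ?mulr_ge0// -natrM ler_nat; lia.
Qed.

Lemma path_resistance_ge0 (R : realType) (a : nat -> R) (p : R) (n N : nat) :
  0 <= path_resistance a p n N.
Proof. by apply: sumr_ge0 => k _; exact: powR_ge0. Qed.

Lemma radial_resistanceE (R : realType) (D p : R) (n N : nat) :
  path_resistance (radial_mu D) p n N =
  \sum_(n <= k < N.+1) (k.+1%:R : R) `^ (- ((D - 1) / (p - 1))).
Proof.
by apply: eq_bigr => k _; rewrite /radial_mu -powRrM mulrN.
Qed.

(** The resistance from n to the boundary is largest for n = 0. *)
Lemma l1_resistance_bound (R : realType) (D p B : R) (Omega : {fset nat})
    (w : Omega -> R) : 1 < p ->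
  has_nontrivial_solution radial_adj (radial_omega D) (radial_mu D) p w ->
  path_resistance (radial_mu D) p 0 (outer_radius Omega) <= B ->
  1 <= lnorm (radial_mu D) 1 w^\+ * B `^ (p - 1).
Proof.
move=> p1 /(@solution_lyapunov _ _ _ _ _ p1).
set N := outer_radius Omega => -[V [V0 VE lyap]] SB.
have S0 := @path_resistance_ge0 R (radial_mu D) p.
have nn : 0 <= \sum_(0 <= n < N.+1) radial_mu D n * V n `^ 1.
  by apply: sumr_ge0 => k _; rewrite mulr_ge0 ?powR_ge0// ltW ?radial_mu_gt0.
apply: le_trans lyap _; rewrite VE// invr1 powRr1// mulr_suml.
apply: ler_sum_nat => n /andP[_ nN].
rewrite powRr1// -mulrA ler_wpM2l ?(ltW (radial_mu_gt0 _ _ _))//.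
rewrite ler_wpM2l// ge0_ler_powR ?nnegrE ?subr_ge0 ?(ltW p1)//.
  exact: le_trans (S0 0 N) SB.
apply: le_trans SB; rewrite [leRHS](@big_cat_nat _ _ _ n)//= 1?ltnW// lerDr.
by apply: sumr_ge0 => k _; exact: powR_ge0.
Qed.

Lemma ls_resistance_bound (R : realType) (D p s B : R) (Omega : {fset nat})
    (w : Omega -> R) : 1 < p -> 1 < s ->
  has_nontrivial_solution radial_adj (radial_omega D) (radial_mu D) p w ->
  let N := outer_radius Omega in
  \sum_(0 <= n < N.+1) radial_mu D n *
    (path_resistance (radial_mu D) p n N `^ (p - 1)) `^ (s / (s - 1)) <= B ->
  1 <= lnorm (radial_mu D) s w^\+ * B `^ (s / (s - 1))^-1.
Proof.
move=> p1 s1 /(@solution_lyapunov _ _ _ _ _ p1) sol N SB.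
have {sol} [V [V0 VE lyap]] := sol.
have s0 : 0 < s by lra.
have s0' : 0 < s / (s - 1) by rewrite divr_gt0//; lra.
have mu0 n : 0 <= radial_mu D n by exact: ltW (radial_mu_gt0 _ _ _).
apply: le_trans lyap _; rewrite VE//.
have conj : s^-1 + (s / (s - 1))^-1 = 1.
  by field; rewrite !gt_eqF//; lra.
apply: le_trans (hoelder_sum _ _ _ _ _ _ _ _ s0 s0' conj mu0 V0 _) _.
  by move=> n; exact: powR_ge0.
rewrite ler_wpM2l ?powR_ge0// ge0_ler_powR ?invr_ge0 ?(ltW s0')//.
  by rewrite nnegrE sumr_ge0// => n _; rewrite mulr_ge0 ?powR_ge0.
rewrite nnegrE; apply: le_trans SB.
by rewrite sumr_ge0// => n _; rewrite mulr_ge0 ?powR_ge0.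
Qed.

Lemma ler_of_mul_powR (R : realType) (K x e L : R) : 0 < K -> 0 < x ->
  1 <= L * (K * x `^ e) -> K^-1 * x `^ (- e) <= L.
Proof.
move=> K0 x0 h.
by rewrite powRN -invfM -div1r ler_pdivrMr// mulr_gt0// powR_gt0.
Qed.

(** * The three estimates *)

(** The exponent b = -(D-1)/(p-1) exceeds -1 exactly when p > D. *)
Lemma radial_l1_estimate_supercritical (R : realType) (D p : R) :
  1 < D -> D < p ->
  exists c : R, 0 < c /\
    forall (Omega : {fset nat}) (w : Omega -> R),
      (2 <= outer_radius Omega)%N ->
      has_nontrivial_solution radial_adj (radial_omega D) (radial_mu D) p w ->
      c * (outer_radius Omega)%:R `^ (- (p - D)) <=
        lnorm (radial_mu D) 1 w^\+.
Proof.
move=> D1 Dp; have p1 : 0 < p - 1 by lra.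
set b := - ((D - 1) / (p - 1)).
have b1 : -1 < b by rewrite ltrN2 ltr_pdivrMr//; lra.
have be : (b + 1) * (p - 1) = p - D by rewrite /b; field; rewrite gt_eqF.
set K := (Num.min (b + 1) 1)^-1 * 2 `^ (b + 1).
have K0 : 0 < K.
  by rewrite mulr_gt0 ?powR_gt0// invr_gt0 lt_min ltr01 andbT; lra.
exists (K `^ (p - 1))^-1; rewrite invr_gt0 powR_gt0//.
split=> // Omega w N2 sol.
apply: ler_of_mul_powR; first exact: powR_gt0.
  by rewrite ltr0n (ltn_trans _ N2).
rewrite -be powRrM -powRM ?powR_ge0 ?(ltW K0)//.
apply: l1_resistance_bound sol _; first by lra.
rewrite radial_resistanceE; apply: le_trans (sum_powR_le _ _ _ b1) _.
rewrite -mulrA ler_wpM2l ?natS_powR_le ?invr_ge0 ?le_min ?ler01 ?andbT//; lra.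
Qed.

(** For p = D the resistance from 0 is a harmonic sum, at most 1 + log(N+1). As
N >= 2, both 1 and log(N+1) <= log(N^2) are bounded by multiples of log N. *)
Lemma radial_l1_estimate_critical (R : realType) (D : R) : 1 < D ->
  exists c : R, 0 < c /\
    forall (Omega : {fset nat}) (w : Omega -> R),
      (2 <= outer_radius Omega)%N ->
      has_nontrivial_solution radial_adj (radial_omega D) (radial_mu D) D w ->
      c * ln ((outer_radius Omega)%:R) `^ (1 - D) <=
        lnorm (radial_mu D) 1 w^\+.
Proof.
move=> D1.
have ln2 : 0 < ln 2 :> R by rewrite ln_gt0// ltr1n.
set K : R := (ln 2)^-1 + 2.
have K0 : 0 < K by rewrite addr_gt0 ?invr_gt0.
exists (K `^ (D - 1))^-1; rewrite invr_gt0 powR_gt0//.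
split=> // Omega w N2 sol.
have N0 : 0 < (outer_radius Omega)%:R :> R by rewrite ltr0n; lia.
have lnN : ln 2 <= ln (outer_radius Omega)%:R :> R.
  by rewrite ler_ln ?posrE// ler_nat.
have lnN0 := lt_le_trans ln2 lnN.
have -> : 1 - D = - (D - 1) by rewrite opprB.
apply: ler_of_mul_powR; rewrite ?powR_gt0//.
rewrite -powRM ?(ltW K0) ?(ltW lnN0)//; apply: l1_resistance_bound sol _ => //.
rewrite radial_resistanceE mulfV ?gt_eqF ?subr_gt0//.
under eq_bigr do rewrite powR_inv1//.
apply: le_trans (sum_inv_le_ln _ _ _) _ => //.
rewrite mulrDl lerD//; first by rewrite ler_pdivlMl// mulr1.
rewrite -[2]/(2%:R) mulr_natl -lnXn// ler_ln ?posrE ?exprn_gt0 ?ltr0Sn//.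
by rewrite -natrX ler_nat; nia.
Qed.

(** With g = (D-p)/(p-1) the resistance from n is O((n+1)^(-g)), and the
weighted power sum that remains has exponent b = D - 1 - (D-p)s'. The
hypothesis D/p < s is equivalent to b > -1, and (b+1)/s' = p - D/s. *)
Lemma radial_ls_estimate_subcritical (R : realType) (D p s : R) :
  1 < p -> p < D -> D / p < s ->
  exists c : R, 0 < c /\
    forall (Omega : {fset nat}) (w : Omega -> R),
      (2 <= outer_radius Omega)%N ->
      has_nontrivial_solution radial_adj (radial_omega D) (radial_mu D) p w ->
      c * (outer_radius Omega)%:R `^ (- (p - D / s)) <=
        lnorm (radial_mu D) s w^\+.
Proof.
move=> p1 pD Dps.
have p0 : 0 < p by lra.
have p10 : 0 < p - 1 by lra.
have s1 : 1 < s by apply: lt_trans Dps; rewrite ltr_pdivlMr// mul1r.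
have s10 : 0 < s - 1 by lra.
have s0 : 0 < s by lra.
set s' := s / (s - 1); have s'0 : 0 < s' by rewrite divr_gt0.
set g := (D - p) / (p - 1).
have g0 : 0 < g by rewrite divr_gt0//; lra.
set C := 2 * (Num.min g 1)^-1.
have C0 : 0 < C by rewrite mulr_gt0// invr_gt0 lt_min g0 ltr01.
set b := D - 1 - g * (p - 1) * s'.
have gp : g * (p - 1) = D - p by rewrite divfK// gt_eqF.
have b1 : -1 < b.
  rewrite /b gp; suff : (D - p) * s' < D by lra.
  rewrite mulrA ltr_pdivrMr//; move: Dps; rewrite ltr_pdivrMr//; nra.
have be : (b + 1) * s'^-1 = p - D / s.
  by rewrite /b gp /s'; field; rewrite !gt_eqF.
set C1 := C `^ ((p - 1) * s').
set K := C1 * ((Num.min (b + 1) 1)^-1 * 2 `^ (b + 1)).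
have C10 : 0 < C1 by rewrite powR_gt0.
have K0 : 0 < K.
  by rewrite !mulr_gt0 ?powR_gt0// invr_gt0 lt_min ltr01 andbT; lra.
exists (K `^ s'^-1)^-1; rewrite invr_gt0 powR_gt0//; split=> // Omega w N2 sol.
apply: ler_of_mul_powR; first exact: powR_gt0.
  by rewrite ltr0n (ltn_trans _ N2).
rewrite -be powRrM -powRM ?powR_ge0 ?(ltW K0)//.
apply: ls_resistance_bound sol _ => //.
set N := outer_radius Omega.
apply: (@le_trans _ _ (C1 * \sum_(0 <= n < N.+1) (n.+1%:R : R) `^ b)).
  rewrite mulr_sumr; apply: ler_sum_nat => n /andP[_ nN].
  have S0 := path_resistance_ge0 R (radial_mu D) p n N.
  have SC : path_resistance (radial_mu D) p n N <= C * n.+1%:R `^ (- g).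
    rewrite radial_resistanceE.
    have -> : (D - 1) / (p - 1) = g + 1 by rewrite /g; field; rewrite gt_eqF.
    by apply: sum_powR_tail_le => //; exact: ltnW.
  have -> : C1 * n.+1%:R `^ b =
      radial_mu D n * (C * n.+1%:R `^ (- g)) `^ ((p - 1) * s').
    rewrite powRM ?powR_ge0 ?(ltW C0)// mulrCA; congr (_ * _).
    rewrite -powRrM -powRD ?pnatr_eq0 ?implybT//; congr (_ `^ _).
    by rewrite /b; ring.
  rewrite -powRrM ler_wpM2l ?(ltW (radial_mu_gt0 _ _ _))//.
  by rewrite ge0_ler_powR ?nnegrE ?(le_trans S0 SC)// mulr_ge0 ?ltW.
rewrite -[leRHS]mulrA ler_wpM2l ?(ltW C10)//.
apply: le_trans (sum_powR_le _ _ _ b1) _.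
rewrite -mulrA ler_wpM2l ?natS_powR_le ?invr_ge0 ?le_min ?ler01 ?andbT//; lra.
Qed.

Theorem theorem3p13 (R : realType) (D : R) (hD : 1 < D) :
  [/\ (forall p : R, 1 < p -> D < p ->
        exists c : R, 0 < c /\
          forall (Omega : {fset nat}) (w : Omega -> R),
            Omega != fset0 -> (2 <= outer_radius Omega)%N ->
            has_nontrivial_solution radial_adj (radial_omega D) (radial_mu D)
              p w ->
            c * (outer_radius Omega)%:R `^ (- (p - D)) <=
              lnorm (radial_mu D) 1 w^\+),
      (forall p : R, 1 < p -> p = D ->
        exists c : R, 0 < c /\
          forall (Omega : {fset nat}) (w : Omega -> R),
            Omega != fset0 -> (2 <= outer_radius Omega)%N ->
            has_nontrivial_solution radial_adj (radial_omega D) (radial_mu D)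
              p w ->
            c * ln ((outer_radius Omega)%:R) `^ (1 - p) <=
              lnorm (radial_mu D) 1 w^\+)
    & (forall p s : R, 1 < p -> p < D -> D / p < s ->
        exists c : R, 0 < c /\
          forall (Omega : {fset nat}) (w : Omega -> R),
            Omega != fset0 -> (2 <= outer_radius Omega)%N ->
            has_nontrivial_solution radial_adj (radial_omega D) (radial_mu D)
              p w ->
            c * (outer_radius Omega)%:R `^ (- (p - D / s)) <=
              lnorm (radial_mu D) s w^\+)].
Proof.
split.
- move=> p p1 Dp.
  have [c [c0 H]] := radial_l1_estimate_supercritical R D p hD Dp.
  by exists c; split=> // Omega w _; exact: H.
- move=> p p1 ->; have [c [c0 H]] := radial_l1_estimate_critical R D hD.
  by exists c; split=> // Omega w _; exact: H.
- move=> p s p1 pD Ds.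
  have [c [c0 H]] := radial_ls_estimate_subcritical R D p s p1 pD Ds.
  by exists c; split=> // Omega w _; exact: H.
Qed.
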